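(* Let $0<p<1$, let $\{X_n,\ n\ge1\}$ be the steps of the elephant random walk that remembers only the first two steps, with $P(X_1=1)=p=1-P(X_1=-1)$, and let $S_n=\sum_{k=1}^n X_k$. Then: (a) as $n\to\infty$, $\dfrac{S_n}{n}$ converges in distribution to a random variable that equals $2p-1$ with probability $p^2$, $0$ with probability $1-p$, and $-(2p-1)$ with probability $p(1-p)$; (b) $E(S_n/n)\to p(2p-1)^2$ and $\mathrm{Var}(S_n/n)\to p(1-p)(2p-1)^2(4p^2+1)$ as $n\to\infty$.
   Context: Elephant random walk remembering only the first two steps: $X_2=X_1$ with probability $p$ and $X_2=-X_1$ with probability $1-p$; for every $n\ge2$, choose $K$ with $P(K=1)=P(K=2)=1/2$ and set $X_{n+1}=X_K$ with probability $p$ and $X_{n+1}=-X_K$ with probability $1-p$. All index choices and sign choices are mutually independent and independent of $X_1$. *)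

(* Defs.v *)
From HB Require Import structures.
From mathcomp Require Export all_boot all_order all_algebra.
From mathcomp Require Export finmap.
From mathcomp Require Export all_classical all_reals all_analysis.
From mathcomp Require Export measurable_realfun.

Set Implicit Arguments.
Unset Strict Implicit.
Unset Printing Implicit Defensive.

Import Order.TTheory GRing.Theory Num.Theory.
Import numFieldNormedType.Exports.

Local Open Scope classical_set_scope.
Local Open Scope ring_scope.

Section sigma_algebras.
Context d (Omega : measurableType d) (R : realType) (P : probability Omega R).

Definition mutually_independent (I : choiceType) (D : set I)
    (G : I -> set (set Omega)) : Prop :=
  forall (J : {fset I}) (A : I -> set Omega),
    [set` J] `<=` D ->
    (forall i, i \in J -> G i (A i)) ->
    P (\bigcap_(i in [set` J]) A i) = (\prod_(i <- J) P (A i))%E.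

Definition sigma_of d' (T : measurableType d') (X : {RV P >-> T}) :
    set (set Omega) :=
  preimage_set_system setT X measurable.

End sigma_algebras.

Definition cvg_in_distribution d (Omega : measurableType d) (R : realType)
    (P : probability Omega R) d' (Omega' : measurableType d')
    (Q : probability Omega' R) (Y : nat -> {RV P >-> R}) (Z : {RV Q >-> R}) :
    Prop :=
  forall x : R, {for x, continuous (cdf Z)} ->
    cdf (Y n) x @[n --> \oo] --> cdf Z x.

Section walk.
Context d (Omega : measurableType d) (R : realType) (P : probability Omega R).

(* Sources of randomness: [None] is the first step [X 1]; [Some (inl n)] is the
   sign choice and [Some (inr n)] the index choice used to form [X n.+1]. *)
Definition erw_source : choiceType := option (nat + nat).

(* Only [X n] with [1 <= n], [keep n] with [1 <= n] and [K n] with [2 <= n]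
   are used; the other terms of these sequences are unconstrained. *)
Definition erw_sources : set erw_source :=
  [set i | match i with
           | None => True
           | Some (inl n) => (1 <= n)%N
           | Some (inr n) => (2 <= n)%N
           end].

Variables (X : nat -> {RV P >-> R}) (keep : nat -> {RV P >-> bool})
  (K : nat -> {RV P >-> nat}).

Definition erw_sigma (i : erw_source) : set (set Omega) :=
  match i with
  | None => sigma_of (X 1)
  | Some (inl n) => sigma_of (keep n)
  | Some (inr n) => sigma_of (K n)
  end.

Record first_two_elephant_walk (p : R) : Prop := FirstTwoElephantWalk {
  erw_first_pos : P [set w | X 1 w = 1] = p%:E;
  erw_first_neg : P [set w | X 1 w = -1] = (1 - p)%:E;
  erw_keep : forall n, (1 <= n)%N -> P [set w | keep n w = true] = p%:E;
  erw_index1 : forall n, (2 <= n)%N -> P [set w | K n w = 1%N] = (2^-1)%:E;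
  erw_index2 : forall n, (2 <= n)%N -> P [set w | K n w = 2%N] = (2^-1)%:E;
  erw_second : forall w, X 2 w = if keep 1 w then X 1 w else - X 1 w;
  erw_next : forall n, (2 <= n)%N -> forall w,
    X n.+1 w = if keep n w then X (K n w) w else - X (K n w) w;
  erw_indep : mutually_independent P erw_sources erw_sigma }.

Definition erw_sum (n : nat) (w : Omega) : R := \sum_(1 <= k < n.+1) X k w.

Definition erw_mean (n : nat) (w : Omega) : R := erw_sum n w / n%:R.

Lemma measurable_erw_mean n : measurable_fun setT (erw_mean n).
Proof.
rewrite /erw_mean /erw_sum; apply: measurable_funM => //.
by apply: measurable_sum => k.
Qed.

HB.instance Definition _ n :=
  isMeasurableFun.Build _ _ _ _ (erw_mean n) (measurable_erw_mean n).

End walk.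

(* Main.v *)
From HB Require Import structures.
Require Import Defs.
From mathcomp Require Import ring lra.
Import Order.TTheory GRing.Theory Num.Theory.
Import numFieldNormedType.Exports.
Set Implicit Arguments.
Unset Strict Implicit.
Unset Printing Implicit Defensive.
Local Open Scope classical_set_scope.
Local Open Scope ring_scope.

(* Given the first two steps, the later steps are i.i.d. with mean
   M = (2p-1)(X_1 + X_2)/2, so the differences X_n - M, n >= 3, are orthogonal
   in L^2 to each other and to X_1 - M and X_2 - M. Hence
   E (S_n/n - M)^2 = O(1/n). This gives convergence in probability to M, so in
   distribution, and convergence of the first two moments to those of M, which
   takes the three values of the statement. Almost surely X_1 = 1 or -1 and
   every index is 1 or 2, so the walk is a function of independent coins and
   all its moments are finite weighted averages. *)

(** * Integration of bounded measurable functions *)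

Section bounded_measurable.
Context d (T : measurableType d) (R : realType) (P : probability T R).
Implicit Types f g : T -> R.

(** Under a probability measure this implies integrability and, unlike integrability, it is stable
    under products; it settles the side conditions of all integrals below. *)
Definition bounded_measurable f :=
  measurable_fun setT f /\ exists C, forall w, `|f w| <= C.

Lemma bounded_measurable_integrable f :
  bounded_measurable f -> P.-integrable setT (EFin \o f).
Proof.
move=> [mf [C fC]]; apply: measurable_bounded_integrable => //.
  by rewrite ltey_eq fin_num_measure.
exists C; split; first exact: num_real.
by move=> y Cy w _ /=; exact: le_trans (fC w) (ltW Cy).
Qed.

Lemma bounded_measurable_cst r : bounded_measurable (fun=> r).
Proof. by split; [exact: measurable_cst | exists `|r|]. Qed.

Lemma bounded_measurableD f g : bounded_measurable f -> bounded_measurable g ->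
  bounded_measurable (fun w => f w + g w).
Proof.
move=> [mf [C fC]] [mg [D gD]]; split; first exact: measurable_funD.
by exists (C + D) => w; rewrite (le_trans (ler_normD _ _))// lerD.
Qed.

Lemma bounded_measurableM f g : bounded_measurable f -> bounded_measurable g ->
  bounded_measurable (fun w => f w * g w).
Proof.
move=> [mf [C fC]] [mg [D gD]]; split; first exact: measurable_funM.
by exists (C * D) => w; rewrite normrM ler_pM.
Qed.

Lemma bounded_measurableB f g : bounded_measurable f -> bounded_measurable g ->
  bounded_measurable (fun w => f w - g w).
Proof.
move=> [mf [C fC]] [mg [D gD]]; split; first exact: measurable_funB.
by exists (C + D) => w; rewrite (le_trans (ler_normB _ _))// lerD.
Qed.

Lemma bounded_measurableX f n : bounded_measurable f ->
  bounded_measurable (fun w => f w ^+ n).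
Proof.
move=> [mf [C fC]]; split; first exact: measurable_funX.
by exists (C ^+ n) => w; rewrite normrX lerXn2r ?nnegrE// (le_trans _ (fC w)).
Qed.

Lemma bounded_measurable_sum (I : Type) (s : seq I) (F : I -> T -> R) :
  (forall i, bounded_measurable (F i)) ->
  bounded_measurable (fun w => \sum_(i <- s) F i w).
Proof.
move=> bF; elim: s => [|i s ih].
  by under eq_fun do rewrite big_nil; exact: bounded_measurable_cst.
by under eq_fun do rewrite big_cons; exact: bounded_measurableD.
Qed.

Lemma bounded_measurable_bool (c : T -> bool) (u : bool -> R) :
  measurable_fun setT c -> bounded_measurable (fun w => u (c w)).
Proof.
move=> mc; split; first exact: (@measurableT_comp _ _ _ _ _ _ u).
by exists (`|u true| + `|u false|) => w; case: (c w);
  rewrite ?lerDl ?lerDr.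
Qed.

Lemma Rintegral_probability_cst r : \int[P]_w r = r.
Proof. by rewrite Rintegral_cst// [X in fine X]probability_setT mulr1. Qed.

Lemma RintegralD_bounded f g : bounded_measurable f -> bounded_measurable g ->
  \int[P]_w (f w + g w) = \int[P]_w f w + \int[P]_w g w.
Proof.
by move=> bf bg; rewrite RintegralD//; exact: bounded_measurable_integrable.
Qed.

Lemma RintegralB_bounded f g : bounded_measurable f -> bounded_measurable g ->
  \int[P]_w (f w - g w) = \int[P]_w f w - \int[P]_w g w.
Proof.
by move=> bf bg; rewrite RintegralB//; exact: bounded_measurable_integrable.
Qed.

Lemma RintegralZl_bounded f r : bounded_measurable f ->
  \int[P]_w (r * f w) = r * \int[P]_w f w.
Proof.
by move=> bf; rewrite RintegralZl//; exact: bounded_measurable_integrable.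
Qed.

Lemma le_Rintegral_bounded f g : bounded_measurable f -> bounded_measurable g ->
  (forall w, f w <= g w) -> \int[P]_w f w <= \int[P]_w g w.
Proof.
move=> bf bg fg; apply: le_Rintegral => //;
  exact: bounded_measurable_integrable.
Qed.

Lemma eq_Rintegral_setT f g : f =1 g -> \int[P]_w f w = \int[P]_w g w.
Proof. by move=> /funext ->. Qed.

Lemma Rintegral_sum_bounded (I : Type) (s : seq I) (F : I -> T -> R) :
  (forall i, bounded_measurable (F i)) ->
  \int[P]_w (\sum_(i <- s) F i w) = \sum_(i <- s) \int[P]_w F i w.
Proof.
move=> bF; elim: s => [|i s ih].
  rewrite big_nil -[RHS]Rintegral_probability_cst.
  by apply: eq_Rintegral_setT => w; rewrite big_nil.
rewrite big_cons -ih -RintegralD_bounded//; last exact: bounded_measurable_sum.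
by apply: eq_Rintegral_setT => w; rewrite big_cons.
Qed.

(* The variance is nonnegative. *)
Lemma sqr_Rintegral_le f : bounded_measurable f ->
  (\int[P]_w f w) ^+ 2 <= \int[P]_w (f w ^+ 2).
Proof.
move=> bf; set m := \int[P]_w f w.
have : 0 <= \int[P]_w ((f w - m) ^+ 2).
  by apply: Rintegral_ge0 => w _; exact: sqr_ge0.
have bmf : bounded_measurable (fun w => 2 * m * f w).
  by apply: bounded_measurableM => //; exact: bounded_measurable_cst.
rewrite (@eq_Rintegral_setT _ (fun w => f w ^+ 2 - 2 * m * f w + m ^+ 2));
  last by move=> w; ring.
rewrite RintegralD_bounded; last exact: bounded_measurable_cst; last first.
  by apply: bounded_measurableB => //; exact: bounded_measurableX.
rewrite RintegralB_bounded//; last exact: bounded_measurableX.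
rewrite RintegralZl_bounded// Rintegral_probability_cst -/m.
by nra.
Qed.

End bounded_measurable.

(** * Finite families of independent biased coins *)

Section independent_coins.
Context d (T : measurableType d) (R : realType) (P : probability T R).
Context (I : choiceType) (D : set I) (c : I -> T -> bool) (q : I -> R).

Definition coin_weight (r : R) (b : bool) : R := if b then r else 1 - r.

Definition coin_event (t : seq (I * bool)) : set T :=
  [set w | all (fun ib => c ib.1 w == ib.2) t].

(** The product formula on cylinders with distinct coins in [D]. Measurability is asked of every
    coin, so that functions of any list of coins are measurable without side condition. *)
Definition independent_coins : Prop :=
  (forall i, measurable_fun setT (c i)) /\
  forall t : seq (I * bool), uniq (unzip1 t) -> {in unzip1 t, forall i, D i} ->
    P (coin_event t) = (\prod_(ib <- t) coin_weight (q ib.1) ib.2)%:E.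

(** The expectation of [F] under the product of Bernoulli laws. Being recursive, it unfolds on a
    concrete list into a rational expression that [ring] or [field] can treat. *)
Fixpoint coin_average (qs : seq R) (F : seq bool -> R) : R :=
  if qs is r :: qs' then
    r * coin_average qs' (fun l => F (true :: l)) +
    (1 - r) * coin_average qs' (fun l => F (false :: l))
  else F [::].

Hypothesis cI : independent_coins.

Lemma bounded_measurable_coins (s : seq I) (F : seq bool -> R) :
  bounded_measurable (fun w => F [seq c i w | i <- s]).
Proof.
elim: s F => [|i s ih] F /=; first exact: bounded_measurable_cst.
(* Splitting by the two outcomes of the first coin leaves only sums and products of functions
   already covered. *)
have -> : (fun w => F (c i w :: [seq c j w | j <- s])) = (fun w =>
    (c i w)%:R * F (true :: [seq c j w | j <- s]) +
    (~~ c i w)%:R * F (false :: [seq c j w | j <- s])).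
  by apply/funext => w; case: (c i w); rewrite /= !(mul1r, mul0r, addr0, add0r).
apply: bounded_measurableD; apply: bounded_measurableM.
- exact: (bounded_measurable_bool (fun b => b%:R) (cI.1 i)).
- exact: (ih (fun l => F (true :: l))).
- exact: (bounded_measurable_bool (fun b => (~~ b)%:R) (cI.1 i)).
- exact: (ih (fun l => F (false :: l))).
Qed.

Lemma coin_event_indic (t : seq (I * bool)) (w : T) :
  (all (fun ib => c ib.1 w == ib.2) t)%:R = \1_(coin_event t) w :> R.
Proof.
by rewrite indicE; congr (_%:R); congr nat_of_bool;
  apply/idP/idP => [h|/set_mem//]; exact: mem_set.
Qed.

Lemma measurable_coin_event (t : seq (I * bool)) : measurable (coin_event t).
Proof.
elim: t => [|[i b] t ih].
  by rewrite (_ : coin_event _ = setT)//; apply/seteqP.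
rewrite [X in measurable X](_ : _ = c i @^-1` [set b] `&` coin_event t).
  by apply: measurableI => //; rewrite -[X in measurable X]setTI; exact: cI.1.
apply/seteqP; split => w; first by move=> /andP[/eqP].
by case=> /= cb ct; rewrite /coin_event/= cb eqxx.
Qed.

(* Induction moves one coin at a time from the argument of [F] into the event
   on which the integral is taken. *)
Lemma Rintegral_coin_event (t : seq (I * bool)) (s : seq I)
    (F : seq bool -> R) :
  uniq (s ++ unzip1 t) -> {in s ++ unzip1 t, forall i, D i} ->
  \int[P]_w ((all (fun ib => c ib.1 w == ib.2) t)%:R * F [seq c i w | i <- s]) =
  (\prod_(ib <- t) coin_weight (q ib.1) ib.2) * coin_average (map q s) F.
Proof.
have bt t' : bounded_measurable
    (fun w => (all (fun ib => c ib.1 w == ib.2) t')%:R : R).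
  split; last by exists 1 => w; case: all; rewrite ?normr1 ?normr0.
  rewrite [X in measurable_fun _ X](_ : _ = \1_(coin_event t')); last first.
    by apply/funext => w; rewrite coin_event_indic.
  by apply: measurable_indic; exact: measurable_coin_event.
elim: s t F => [|i s ih] t F /= ut tD.
  (* No coin is left in [F]: a constant times the probability of a cylinder. *)
  transitivity (\int[P]_w (F [::] * (all (fun ib => c ib.1 w == ib.2) t)%:R)).
    by apply: eq_Rintegral_setT => w; rewrite mulrC.
  rewrite RintegralZl_bounded// mulrC; congr (_ * _).
  rewrite -[RHS]/(fine (_%:E)) -(cI.2 t)// -[in RHS](setIT (coin_event t)).
  rewrite -integral_indic//; last exact: measurable_coin_event.
  by congr fine; apply: eq_integral => w _; rewrite coin_event_indic.
have bF b : bounded_measurable (fun w =>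
    (all (fun ib => c ib.1 w == ib.2) ((i, b) :: t))%:R *
    F (b :: [seq c j w | j <- s])).
  apply: bounded_measurableM => //.
  exact: (bounded_measurable_coins s (fun l => F (b :: l))).
transitivity (\int[P]_w (
    (all (fun ib => c ib.1 w == ib.2) ((i, true) :: t))%:R *
    F (true :: [seq c j w | j <- s]) +
    (all (fun ib => c ib.1 w == ib.2) ((i, false) :: t))%:R *
    F (false :: [seq c j w | j <- s]))).
  by apply: eq_Rintegral_setT => w /=; case: (c i w);
    rewrite /= !(mul0r, addr0, add0r).
have perm_t : perm_eq (s ++ i :: unzip1 t) (i :: s ++ unzip1 t).
  by rewrite perm_catC/= perm_cons perm_catC.
rewrite RintegralD_bounded//.
rewrite (ih ((i, true) :: t) (fun l => F (true :: l))); last 2 first.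
- by rewrite (perm_uniq perm_t).
- by move=> j; rewrite /= (perm_mem perm_t); exact: tD.
rewrite (ih ((i, false) :: t) (fun l => F (false :: l))); last 2 first.
- by rewrite (perm_uniq perm_t).
- by move=> j; rewrite /= (perm_mem perm_t); exact: tD.
by rewrite !big_cons /=; ring.
Qed.

(** The case of no prescribed coin, where the event is the whole space. *)
Lemma Rintegral_coins (s : seq I) (F : seq bool -> R) :
  uniq s -> {in s, forall i, D i} ->
  \int[P]_w F [seq c i w | i <- s] = coin_average (map q s) F.
Proof.
move=> us sD; have := @Rintegral_coin_event [::] s F.
rewrite cats0 => /(_ us sD).
by rewrite big_nil mul1r => <-; apply: eq_Rintegral_setT => w; rewrite mul1r.
Qed.

End independent_coins.

(** * Limits from a quadratic rate, moments up to null sets, Chebyshev's inequality *)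

Lemma cvg_of_sqr_le_div (R : realType) (u : nat -> R) (l C : R) :
  (forall n, (0 < n)%N -> (u n - l) ^+ 2 <= C / n%:R) -> u @ \oo --> l.
Proof.
move=> uC; apply/cvgrPdist_le => e e0; near=> n.
have n0 : (0 < n)%N by near: n; exact: nbhs_infty_gt.
rewrite distrC -(ler_pXn2r (n := 2)) ?nnegrE ?(ltW e0)//.
rewrite real_normK ?num_real// (le_trans (uC _ n0))// ler_pdivrMr ?ltr0n//.
rewrite mulrC -ler_pdivrMr ?exprn_gt0//.
by near: n; exact: nbhs_infty_ger.
Unshelve. all: by end_near. Qed.

Lemma expectation_ae_eq d (T : measurableType d) (R : realType)
    (P : probability T R) (f g : T -> R) :
  measurable_fun setT f -> measurable_fun setT g ->
  (\forall w \ae P, f w = g w) -> 'E_P[f]%E = 'E_P[g]%E.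
Proof.
move=> mf mg fg; rewrite unlock; apply: ae_eq_integral => //.
- exact/measurable_EFinP.
- exact/measurable_EFinP.
- by apply: filterS fg => w fgw _ /=; rewrite fgw.
Qed.

Lemma expectation_bounded d (T : measurableType d) (R : realType)
    (P : probability T R) (f : T -> R) :
  bounded_measurable f -> 'E_P[f]%E = (\int[P]_w f w)%:E.
Proof.
move=> bf; rewrite unlock fineK// integrable_fin_num//.
exact: bounded_measurable_integrable.
Qed.

(** The walk may take arbitrary values on a null set, so its variance is computed on a bounded
    version [g]. *)
Lemma variance_bounded_ae d (T : measurableType d) (R : realType)
    (P : probability T R) (f g : T -> R) :
  measurable_fun setT f -> bounded_measurable g ->
  (\forall w \ae P, f w = g w) ->
  'V_P[f]%E = (\int[P]_w (g w ^+ 2) - (\int[P]_w g w) ^+ 2)%:E.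
Proof.
move=> mf bg fg; rewrite /variance unlock (expectation_ae_eq mf bg.1 fg).
rewrite (expectation_bounded P bg) /=; set m := \int[P]_w g w.
have bgm : bounded_measurable (fun w => (g w - m) ^+ 2).
  apply/bounded_measurableX/bounded_measurableB => //.
  exact: bounded_measurable_cst.
rewrite (@expectation_ae_eq _ _ _ P _ (fun w => (g w - m) ^+ 2)); last 3 first.
- by apply: measurable_funM; apply: measurable_funB.
- exact: bgm.1.
- by apply: filterS fg => w fgw /=; rewrite !fctE /= fgw expr2.
rewrite expectation_bounded//; congr (_%:E).
have b2m : bounded_measurable (fun w => 2 * m * g w).
  by apply: bounded_measurableM => //; exact: bounded_measurable_cst.
rewrite (@eq_Rintegral_setT _ _ _ _ _
  (fun w => g w ^+ 2 - 2 * m * g w + m ^+ 2)); last by move=> w; ring.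
rewrite RintegralD_bounded; [|apply: bounded_measurableB => //;
  exact: bounded_measurableX|exact: bounded_measurable_cst].
rewrite RintegralB_bounded//; last exact: bounded_measurableX.
by rewrite RintegralZl_bounded// Rintegral_probability_cst -/m; ring.
Qed.

(** Markov's inequality for the function [r ^+ 2], nondecreasing on nonnegative reals, applied to
    [|f|]. *)
Lemma markov_sqr d (T : measurableType d) (R : realType)
    (P : probability T R) (f : T -> R) (e : R) :
  measurable_fun setT f -> 0 < e ->
  ((e ^+ 2)%:E * P [set w | (e <= `|f w|)%R] <= 'E_P[fun w => (f w ^+ 2)%R])%E.
Proof.
move=> mf e0; pose mF := isMeasurableFun.Build _ _ _ _ f mf.
pose F : {RV P >-> R} := HB.pack f mF.
have := @markov _ _ _ P F (fun r => r ^+ 2) e e0.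
rewrite (_ : _ \o _ \o _ = fun w => f w ^+ 2); last first.
  by apply/funext => w /=; rewrite real_normK ?num_real.
apply => //.
- by move=> r r0; exact: sqr_ge0.
- by move=> x y; rewrite !nnegrE => x0 y0 xy; rewrite lerXn2r.
Qed.

(** * Convergence in probability implies convergence in distribution *)

Section convergence_in_probability.
Context d (T : measurableType d) (R : realType) (P : probability T R).
Context (Y : nat -> {RV P >-> R}) (Z : {RV P >-> R}).

Lemma measurable_deviation (U V : {RV P >-> R}) (e : R) :
  measurable [set w | e <= `|U w - V w|].
Proof.
rewrite (_ : mkset _ = (fun w => `|U w - V w|) @^-1` `[e, +oo[).
  rewrite -[X in measurable X]setTI.
  suff : measurable_fun setT (fun w => `|U w - V w|) by exact.
  by apply: measurableT_comp => //; exact: measurable_funB.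
by apply/seteqP; split => w /=; rewrite in_itv/= andbT.
Qed.

(** If [U w <= x], then [V w <= x + e] unless the two values differ by at least [e]. *)
Lemma cdf_le_deviation (U V : {RV P >-> R}) (x e : R) :
  (cdf U x <= cdf V (x + e)%R + P [set w | (e <= `|U w - V w|)%R])%E.
Proof.
have mUV := measurable_deviation U V e.
have mle (W : {RV P >-> R}) y : measurable (W @^-1` `]-oo, y]).
  by rewrite -[X in measurable X]setTI; exact: measurable_funP.
have := measureU2 P (mle V (x + e)) mUV; apply: le_trans.
apply: (@le_measure _ _ _ P); rewrite ?inE//; first exact: measurableU.
move=> w /=; rewrite !in_itv/= => Uwx.
have [eUV|] := leP e `|U w - V w|; [by right|rewrite ltr_norml => /andP[? ?]].
by left; lra.
Qed.

(** Up to the probability of a deviation, the cdf of [Y n] at [x] lies between those of [Z] at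
    [x - r / 2] and [x + r / 2], which continuity at [x] brings together. *)
Lemma cvg_in_distribution_of_probability :
  (forall e, 0 < e ->
     P [set w | e <= `|Y n w - Z w|] @[n --> \oo] --> 0%E) ->
  cvg_in_distribution Y Z.
Proof.
move=> YZ x cZ.
have fin (W : {RV P >-> R}) y : cdf W y \is a fin_num by exact: fin_num_measure.
have {}cZ : fine (cdf Z y) @[y --> x] --> fine (cdf Z x).
  by apply: fine_cvg; rewrite fineK//; exact: cZ.
rewrite -(fineK (fin Z x)); apply/fine_cvgP; split; first by near=> n.
apply/cvgrPdist_le => e e0.
have e20 : 0 < e / 2 by rewrite divr_gt0.
move/cvgrPdist_le : cZ => /(_ _ e20) /nbhs_ballP[r /= r0 rZ].
(* Half the radius, so that both shifted points lie in the open ball. *)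
have r20 : 0 < r / 2 by rewrite divr_gt0.
have Zr : `|fine (cdf Z x) - fine (cdf Z (x + r / 2))| <= e / 2.
  by apply: rZ; rewrite /ball/= opprD addNKr normrN gtr0_norm//; lra.
have Zl : `|fine (cdf Z x) - fine (cdf Z (x - r / 2))| <= e / 2.
  by apply: rZ; rewrite /ball/= opprB addrCA subrr addr0 gtr0_norm//; lra.
have {}YZ : fine (P [set w | r / 2 <= `|Y n w - Z w|]) @[n --> \oo] --> 0.
  by apply: fine_cvg; exact: YZ.
near=> n.
have dev_fin : P [set w | r / 2 <= `|Y n w - Z w|] \is a fin_num.
  by apply: fin_num_measure; exact: measurable_deviation.
have dev_le : fine (P [set w | r / 2 <= `|Y n w - Z w|]) <= e / 2.
  near: n.
  move/cvgrPdist_le : YZ => /(_ _ e20); apply: filterS => n.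
  by rewrite sub0r normrN; exact: le_trans (ler_norm _).
have up := cdf_le_deviation (Y n) Z x (r / 2).
(* Exchanging the roles of [Y n] and [Z] gives the lower estimate. *)
have low := cdf_le_deviation Z (Y n) (x - r / 2) (r / 2).
move: up low; rewrite subrK.
rewrite (_ : [set w | _ <= `|Z w - _|] = [set w | r / 2 <= `|Y n w - Z w|]);
  last first.
  by apply/seteqP; split => w /=; rewrite distrC.
rewrite -(fineK (fin (Y n) x)) -(fineK (fin Z (x + r / 2))).
rewrite -(fineK (fin Z (x - r / 2))) -(fineK dev_fin).
rewrite -!EFinD !lee_fin => up low.
move: Zr Zl; rewrite !ler_norml => /andP[? ?] /andP[? ?].
by apply/andP; split; lra.
Unshelve. all: by end_near. Qed.

End convergence_in_probability.

(** * The walk as a function of coins and its [L^2] distance to the limit *)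

Section coin_walk.
Context d (T : measurableType d) (R : realType) (P : probability T R) (p : R).
Variable c : erw_source -> T -> bool.

Definition erw_bias (i : erw_source) : R :=
  if i is Some (inr _) then 2^-1 else p.

Definition bit_sign (b : bool) : R := if b then 1 else -1.

(* [a] is the sign of the first step, [k] and [e] are the sign choices for the
   second step and the current one, and [r] tells whether the index is 1. *)
Definition bit_step (a k e r : bool) : R :=
  bit_sign e * (if r then bit_sign a else bit_sign a * bit_sign k).

(* This is [(2 * p - 1) * (X 1 + X 2) / 2], which is [0] when [X 2 = - X 1]. *)
Definition bit_limit (a k : bool) : R :=
  if k then (2 * p - 1) * bit_sign a else 0.

(** The value at [0] is a filler, as sums start at [1]. From the third step on, step [m.+1] uses the
    coins numbered [m], as in the walk. *)
Definition coin_step (n : nat) (w : T) : R :=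
  match n with
  | 0 | 1 => bit_sign (c None w)
  | 2 => bit_sign (c None w) * bit_sign (c (Some (inl 1%N)) w)
  | m.+1 => bit_step (c None w) (c (Some (inl 1%N)) w)
              (c (Some (inl m)) w) (c (Some (inr m)) w)
  end.

Definition coin_limit (w : T) : R :=
  bit_limit (c None w) (c (Some (inl 1%N)) w).

Definition coin_mean (n : nat) (w : T) : R :=
  (\sum_(1 <= k < n.+1) coin_step k w) / n%:R.

Hypotheses (p0 : 0 < p) (p1 : p < 1).
Hypothesis cI : independent_coins P erw_sources c erw_bias.

Lemma norm_bit_sign b : `|bit_sign b| = 1.
Proof. by case: b; rewrite /= ?normrN normr1. Qed.

Lemma norm_coin_step n w : `|coin_step n w| = 1.
Proof.
case: n => [|[|[|n]]] /=; rewrite /bit_step; try case: ifP => _;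
  by rewrite ?normrM !norm_bit_sign ?mulr1.
Qed.

Lemma norm_coin_limit w : `|coin_limit w| <= 1.
Proof.
rewrite /coin_limit /bit_limit; case: ifP => _; last by rewrite normr0.
rewrite normrM norm_bit_sign mulr1 ler_norml.
by apply/andP; split; move: p0 p1; lra.
Qed.

Lemma bounded_measurable_coin_step n : bounded_measurable (coin_step n).
Proof.
split; last by exists 1 => w; rewrite norm_coin_step.
have b1 := bounded_measurable_coins cI [:: None]
  (fun l => bit_sign (nth false l 0)).
case: n => [|[|[|n]]]; [exact: b1.1 | exact: b1.1 | |].
  exact: (bounded_measurable_coins cI [:: None; Some (inl 1%N)]
    (fun l => bit_sign (nth false l 0) * bit_sign (nth false l 1))).1.
exact: (bounded_measurable_coins cI
  [:: None; Some (inl 1%N); Some (inl n.+2); Some (inr n.+2)]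
  (fun l => let b := nth false l in
     bit_step (b 0%N) (b 1%N) (b 2%N) (b 3%N))).1.
Qed.

Lemma bounded_measurable_coin_limit : bounded_measurable coin_limit.
Proof.
exact: (bounded_measurable_coins cI [:: None; Some (inl 1%N)]
  (fun l => bit_limit (nth false l 0) (nth false l 1))).
Qed.

(** Sum over the four outcomes of two coins. Taking [g] an indicator gives the law of the limit,
    taking [g] a power gives its moments. *)
Lemma Rintegral_limit (g : R -> R) : \int[P]_w g (coin_limit w) =
  p ^+ 2 * g (2 * p - 1) + (1 - p) * g 0 + p * (1 - p) * g (- (2 * p - 1)).
Proof.
have /= := @Rintegral_coins _ _ _ _ _ _ _ _ cI [:: None; Some (inl 1%N)]
  (fun l => g (bit_limit (nth false l 0) (nth false l 1))) isT.
rewrite -/coin_limit => ->; last by move=> i; rewrite !inE => /orP[] /eqP ->.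
rewrite /bit_limit /bit_sign.
by rewrite mulr1 mulrN1; ring.
Qed.

(** The sign coin has mean [2 * p - 1] and the index coin averages the first two steps. As [u] is
    arbitrary, the conditional mean given these two steps vanishes. *)
Lemma coin_step_centered (u : bool -> bool -> R) n : (2 < n)%N ->
  \int[P]_w (u (c None w) (c (Some (inl 1%N)) w) *
             (coin_step n w - coin_limit w)) = 0.
Proof.
case: n => [|[|[|n]]]// _.
have /= := @Rintegral_coins _ _ _ _ _ _ _ _ cI
  [:: None; Some (inl 1%N); Some (inl n.+2); Some (inr n.+2)]
  (fun l => let b := nth false l in u (b 0%N) (b 1%N) *
     (bit_step (b 0%N) (b 1%N) (b 2%N) (b 3%N) -
      bit_limit (b 0%N) (b 1%N))) isT.
rewrite -/coin_limit => ->; last by move=> i; rewrite !inE => /or4P[] /eqP ->.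
by rewrite /bit_step /bit_limit /bit_sign /=; field.
Qed.

(** For [m <= 2] the first factor depends on the first two steps only; for larger [m] the two
    factors are conditionally independent and centered. The pair [(1, 2)] is excluded: its inner
    product is [- (1 - p) * (2 * p - 1) ^+ 2]. *)
Lemma coin_step_orthogonal m n : (0 < m < n)%N -> (2 < n)%N ->
  \int[P]_w ((coin_step m w - coin_limit w) *
             (coin_step n w - coin_limit w)) = 0.
Proof.
case: m => [|[|[|m]]]//=.
- move=> _; exact: (coin_step_centered (fun a k => bit_sign a - bit_limit a k)).
- move=> _; exact: (coin_step_centered
    (fun a k => bit_sign a * bit_sign k - bit_limit a k)).
case: n => [|[|[|n]]]// mn _.
have /= := @Rintegral_coins _ _ _ _ _ _ _ _ cI
  [:: None; Some (inl 1%N); Some (inl m.+2); Some (inr m.+2);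
      Some (inl n.+2); Some (inr n.+2)]
  (fun l => let b := nth false l in
     (bit_step (b 0%N) (b 1%N) (b 2%N) (b 3%N) - bit_limit (b 0%N) (b 1%N)) *
     (bit_step (b 0%N) (b 1%N) (b 4%N) (b 5%N) - bit_limit (b 0%N) (b 1%N))).
rewrite -/coin_limit => ->.
- by rewrite /bit_step /bit_limit /bit_sign /=; field.
(* The six coins are distinct because [m] and [n] differ. *)
- rewrite /= !inE /=.
  rewrite -[_ == Some _]/(m.+2 == n.+2) -[Some (inr _) == _]/(m.+2 == n.+2).
  by rewrite ltn_eqF.
- by move=> i; rewrite !inE => /or3P[/eqP->|/eqP->|/or4P[] /eqP ->].
Qed.

Let Z n w := coin_step n w - coin_limit w.

Let bZ n : bounded_measurable (Z n).
Proof.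
exact: bounded_measurableB (bounded_measurable_coin_step n)
  bounded_measurable_coin_limit.
Qed.

Let Z_sqr_le n w : Z n w ^+ 2 <= 4.
Proof.
have : `|Z n w| <= 2.
  rewrite (le_trans (ler_normB _ _))// norm_coin_step.
  by rewrite -[leRHS]/(1 + 1) lerD2l norm_coin_limit.
by rewrite ler_norml => /andP[? ?]; nra.
Qed.

(** By orthogonality, each step from the third on adds only its own second moment, at most [4]. *)
Lemma sqr_sum_coin_step n :
  \int[P]_w ((\sum_(1 <= k < n.+1) (coin_step k w - coin_limit w)) ^+ 2)
  <= 8 * n%:R.
Proof.
change (\int[P]_w ((\sum_(1 <= k < n.+1) Z k w) ^+ 2) <= 8 * n%:R).
have bS m : bounded_measurable (fun w => \sum_(1 <= k < m) Z k w).
  exact: bounded_measurable_sum.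
elim: n => [|n ih].
  rewrite mulr0 (@eq_Rintegral_setT _ _ _ _ _ (fun=> 0)).
    by rewrite Rintegral_probability_cst.
  by move=> w; rewrite big_geq// expr2 mulr0.
(* The first two steps are bounded pointwise; [4 * 2 ^+ 2 = 8 * 2] is what fixes the constant
   [8]. *)
case: (leqP n 1) => [n1|n1].
  have : \int[P]_w ((\sum_(1 <= k < n.+2) Z k w) ^+ 2) <=
      \int[P]_w (4 * n.+1%:R ^+ 2).
    apply: le_Rintegral_bounded => [||w].
    - exact: bounded_measurableX.
    - exact: bounded_measurable_cst.
    - have Zw k := Z_sqr_le k w; case: n n1 {ih} => [|[|]]// _.
        by rewrite big_nat1 expr1n mulr1.
      rewrite 2?big_nat_recr//= big_geq// add0r.
      by have := Zw 1%N; have := Zw 2%N; nra.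
  rewrite Rintegral_probability_cst => /le_trans; apply.
  by case: n n1 {ih} => [|[|]]// _; lra.
rewrite (@eq_Rintegral_setT _ _ _ _ _ (fun w =>
   (\sum_(1 <= k < n.+1) Z k w) ^+ 2 +
   (2 * \sum_(1 <= k < n.+1) (Z k w * Z n.+1 w) + Z n.+1 w ^+ 2)));
  last first.
  by move=> w; rewrite big_nat_recr//= -mulr_suml; ring.
have bC : bounded_measurable (fun w => \sum_(1 <= k < n.+1) (Z k w * Z n.+1 w)).
  by apply: bounded_measurable_sum => k; exact: bounded_measurableM.
have b2C : bounded_measurable
    (fun w => 2 * \sum_(1 <= k < n.+1) (Z k w * Z n.+1 w)).
  by apply: bounded_measurableM => //; exact: bounded_measurable_cst.
rewrite !RintegralD_bounded//; last 3 first.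
- exact: bounded_measurableX.
- exact: bounded_measurableX.
- by apply: bounded_measurableD => //; exact: bounded_measurableX.
rewrite RintegralZl_bounded// Rintegral_sum_bounded; last first.
  by move=> k; exact: bounded_measurableM.
rewrite big_nat big1 ?mulr0 ?add0r; last first.
  by move=> k kn; exact: coin_step_orthogonal.
have : \int[P]_w (Z n.+1 w ^+ 2) <= \int[P]_w 4.
  apply: le_Rintegral_bounded => //.
  - exact: bounded_measurableX.
  - exact: bounded_measurable_cst.
rewrite Rintegral_probability_cst -[in leRHS]natr1.
lra.
Qed.

Lemma bounded_measurable_coin_mean n : bounded_measurable (coin_mean n).
Proof.
apply: bounded_measurableM; last exact: bounded_measurable_cst.
by apply: bounded_measurable_sum => k; exact: bounded_measurable_coin_step.
Qed.

Lemma norm_coin_mean n w : `|coin_mean n w| <= 1.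
Proof.
(* At [n = 0] the division by zero returns [0]. *)
case: n => [|n]; first by rewrite /coin_mean invr0 mulr0 normr0.
rewrite normrM [X in _ * X]ger0_norm ?invr_ge0 ?ler0n//.
rewrite ler_pdivrMr ?ltr0n// mul1r.
rewrite (le_trans (ler_norm_sum _ _ _))//.
rewrite (eq_bigr (fun=> 1)); last by move=> k _; rewrite norm_coin_step.
by rewrite sumr_const_nat subn1.
Qed.

Lemma coin_mean_L2 n : (0 < n)%N ->
  \int[P]_w ((coin_mean n w - coin_limit w) ^+ 2) <= 8 / n%:R.
Proof.
move=> n0; have n0' : n%:R != 0 :> R by rewrite pnatr_eq0 -lt0n.
rewrite (@eq_Rintegral_setT _ _ _ _ _ (fun w => n%:R ^- 2 *
   (\sum_(1 <= k < n.+1) Z k w) ^+ 2)); last first.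
  move=> w; rewrite /coin_mean /Z sumrB sumr_const_nat subn1 /= -mulr_natr.
  by field.
rewrite RintegralZl_bounded; last first.
  by apply: bounded_measurableX; exact: bounded_measurable_sum.
rewrite mulrC ler_pdivrMr ?exprn_gt0 ?ltr0n//.
rewrite (le_trans (sqr_sum_coin_step n))//.
by rewrite le_eqVlt; apply/orP; left; apply/eqP; field.
Qed.

End coin_walk.

(** * Reduction of the walk to independent coins *)

Lemma ae_setU2 d (T : measurableType d) (R : realType) (P : probability T R)
    (A B : set T) (r : R) :
  measurable A -> measurable B -> A `&` B = set0 ->
  P A = r%:E -> P B = (1 - r)%:E -> \forall w \ae P, A w \/ B w.
Proof.
move=> mA mB AB PA PB; apply/negligibleP.
  by apply: measurableC; exact: measurableU.
change (P (~` (A `|` B)) = 0%E).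
rewrite probability_setC; last exact: measurableU.
have -> : P (A `|` B) = (P A + P B)%E.
  exact: measureU.
by rewrite PA PB -EFinD subrKC subrr.
Qed.

Lemma sigma_of_preimage d (T : measurableType d) (R : realType)
    (P : probability T R) d' (T' : measurableType d') (Y : {RV P >-> T'})
    (A : set T') : measurable A -> sigma_of Y (Y @^-1` A).
Proof. by move=> mA; exists A => //; rewrite setTI. Qed.

Section walk_coins.
Context d (T : measurableType d) (R : realType) (P : probability T R) (p : R).
Variables (X : nat -> {RV P >-> R}) (keep : nat -> {RV P >-> bool})
  (K : nat -> {RV P >-> nat}).

(** Any first step other than [1] is read as [-1], and any index other than [1] as [2]; this is
    right almost surely. *)
Definition walk_coin (i : erw_source) (w : T) : bool :=
  match i with
  | None => X 1%N w == 1
  | Some (inl n) => keep n w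
  | Some (inr n) => K n w == 1%N
  end.

Hypothesis hX : first_two_elephant_walk X keep K p.

Lemma walk_coin_sigma i b : erw_sigma X keep K i (walk_coin i @^-1` [set b]).
Proof.
case: i => [[n|n]|] /=.
- exact: sigma_of_preimage.
- rewrite (_ : _ @^-1` _ = K n @^-1` [set k | (k == 1%N) = b]) //.
  exact: sigma_of_preimage.
- rewrite (_ : _ @^-1` _ = X 1%N @^-1` [set x | (x == 1) = b]) //.
  apply: sigma_of_preimage; case: b.
    rewrite (_ : mkset _ = [set 1]) //.
    by apply/seteqP; split => x /= /eqP.
  rewrite (_ : mkset _ = ~` [set 1]); first exact: measurableC.
  by apply/seteqP; split => x /= /eqP // /negbTE.
Qed.

Lemma measurable_walk_coin_preimage i b :
  measurable (walk_coin i @^-1` [set b]).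
Proof.
by have := walk_coin_sigma i b; case: i => [[n|n]|] [A mA <-];
  exact: measurable_funP.
Qed.

Lemma walk_coin_prob i b : erw_sources i ->
  P (walk_coin i @^-1` [set b]) = (coin_weight (erw_bias p i) b)%:E.
Proof.
move=> iD.
have Ptrue : P (walk_coin i @^-1` [set true]) = (erw_bias p i)%:E.
  case: i iD => [[n|n]|] /= iD.
  - exact: (erw_keep hX).
  - rewrite -(erw_index1 hX iD); congr (P _).
    by apply/seteqP; split => w /= /eqP.
  - rewrite -(erw_first_pos hX); congr (P _).
    by apply/seteqP; split => w /= /eqP.
case: b => //=; rewrite EFinB -Ptrue -probability_setC; last first.
  exact: measurable_walk_coin_preimage.
by congr (P _); apply/seteqP; split => w /=; case: walk_coin.
Qed.

(** A cylinder is a finite intersection of events, one in the sigma-algebra of each listed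
    source. *)
Lemma independent_walk_coins :
  independent_coins P erw_sources walk_coin (erw_bias p).
Proof.
split => [i|t ut tD].
  apply: (measurable_fun_bool true) => //.
  by rewrite setTI; exact: measurable_walk_coin_preimage.
(* The bit prescribed for [i] is read off as membership of [(i, true)]; this is faithful because no
   index occurs twice in [t]. *)
pose A i := walk_coin i @^-1` [set (i, true) \in t].
have val_t i b : (i, b) \in t -> ((i, true) \in t) = b.
  case: b => // ibt; apply/negP => itt.
  have pt : perm_eq (unzip1 t) (i :: unzip1 (rem (i, false) t)).
    exact: (perm_map fst (perm_to_rem ibt)).
  have := ut; rewrite (perm_uniq pt) /=.
  case/andP => /mapP[]; exists (i, true) => //.
  by rewrite (mem_rem_uniq _ (map_uniq ut)) !inE itt xpair_eqE andbF.
have -> : coin_event walk_coin t =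
    \bigcap_(i in [set` [fset i in unzip1 t]%fset]) A i.
  apply/seteqP; split => w.
    move=> /allP /= ct i; rewrite /= !inE => /mapP[[j b] jbt ->] /=.
    by rewrite /A /= (val_t _ _ jbt); apply/eqP; exact: (ct _ jbt).
  move=> wA; apply/allP => -[i b] ibt /=; rewrite -(val_t _ _ ibt).
  apply/eqP/(wA i); rewrite /= !inE; apply/mapP; by exists (i, b).
rewrite (erw_indep hX); first last.
- by move=> i _; exact: walk_coin_sigma.
- by move=> i /=; rewrite !inE; exact: tD.
rewrite (perm_big (unzip1 t)); last first.
  by apply: uniq_perm => // i; rewrite inE.
rewrite big_map -prodEFin big_seq [RHS]big_seq; apply: eq_bigr => -[i b] ibt /=.
rewrite walk_coin_prob ?(val_t _ _ ibt)//.
by apply: tD; apply/mapP; exists (i, b).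
Qed.

(** Countably many null sets are discarded, so a single exceptional set serves all [n]; outside it
    the recursion of the walk is that of the coins. *)
Lemma walk_coin_step :
  \forall w \ae P, forall n, (0 < n)%N -> X n w = coin_step R walk_coin n w.
Proof.
have aeX : \forall w \ae P, X 1%N w = 1 \/ X 1%N w = -1.
  apply: ae_setU2 (erw_first_pos hX) (erw_first_neg hX).
  - exact: (@measurable_funPTI _ _ _ _ (X 1%N) [set 1]).
  - exact: (@measurable_funPTI _ _ _ _ (X 1%N) [set -1]).
  - apply/seteqP; split => w //= -[-> /eqP].
    by rewrite -subr_eq0 opprK -mulr2n pnatr_eq0.
have aeK : \forall w \ae P, forall n, (2 <= n)%N -> K n w = 1%N \/ K n w = 2%N.
  apply/ae_foralln => n; case: (leqP 2 n) => [n2|n2]; last by near=> w.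
  have aeKn : \forall w \ae P, K n w = 1%N \/ K n w = 2%N.
    apply: ae_setU2 (erw_index1 hX n2) _.
    - exact: (@measurable_funPTI _ _ _ _ (K n) [set 1%N]).
    - exact: (@measurable_funPTI _ _ _ _ (K n) [set 2%N]).
    - by apply/seteqP; split => w //= -[->].
    - by rewrite (erw_index2 hX n2); congr (_%:E); field.
  by apply: filterS aeKn.
apply: filterS2 aeX aeK => w X1w Kw.
have X1 : X 1%N w = bit_sign R (walk_coin None w).
  case: X1w => X1w; rewrite /= X1w /bit_sign ?eqxx//.
  by rewrite -subr_eq0 -opprD oppr_eq0 -mulr2n pnatr_eq0.
have X2 : X 2%N w =
    bit_sign R (walk_coin None w) * bit_sign R (walk_coin (Some (inl 1%N)) w).
  rewrite (erw_second hX) X1 /=.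
  by case: (keep 1%N w); rewrite /bit_sign ?mulr1 ?mulrN1.
case=> [|[|[|n]]]// _.
rewrite (erw_next hX)// /coin_step /bit_step -X2 -X1 /=.
have -> : X (K n.+2 w) w = if K n.+2 w == 1%N then X 1%N w else X 2%N w.
  by case: (Kw n.+2 isT) => ->.
by case: (keep _ w); rewrite /bit_sign ?mul1r ?mulN1r.
Unshelve. all: by end_near. Qed.

Lemma walk_mean_ae n :
  \forall w \ae P, erw_mean X n w = coin_mean R walk_coin n w.
Proof.
apply: filterS walk_coin_step => w Xw; congr (_ / _).
by apply: eq_big_nat => k /andP[k0 _]; exact: Xw.
Qed.

End walk_coins.

(** * Limit law, mean and variance *)

Theorem theorem6p1 (R : realType) (p : R) (hp0 : 0 < p) (hp1 : p < 1)
    (d : measure_display) (Omega : measurableType d) (P : probability Omega R)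
    (X : nat -> {RV P >-> R}) (keep : nat -> {RV P >-> bool})
    (K : nat -> {RV P >-> nat})
    (hX : first_two_elephant_walk X keep K p) :
  (exists (d' : measure_display) (Omega' : measurableType d')
      (Q : probability Omega' R) (Z : {RV Q >-> R}),
    (forall A : set R, measurable A ->
       distribution Q Z A =
         ((p ^+ 2)%R%:E * \d_(2 * p - 1)%R A
          + (1 - p)%R%:E * \d_(0 : R)%R A
          + (p * (1 - p))%R%:E * \d_(- (2 * p - 1))%R A)%E) /\
    cvg_in_distribution (fun n => erw_mean X n : {RV P >-> R}) Z) /\
  ('E_P[erw_mean X n])%E @[n --> \oo] --> (p * (2 * p - 1) ^+ 2)%:E /\
  ('V_P[erw_mean X n])%E @[n --> \oo]
    --> (p * (1 - p) * (2 * p - 1) ^+ 2 * (4 * p ^+ 2 + 1))%:E.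
Proof.
pose c := walk_coin X keep K.
have cI : independent_coins P erw_sources c (erw_bias p).
  exact: independent_walk_coins.
pose V := coin_mean R c; pose M := coin_limit p c.
have bM : bounded_measurable M := bounded_measurable_coin_limit cI.
have bV n : bounded_measurable (V n) := bounded_measurable_coin_mean cI n.
have bVM n : bounded_measurable (fun w => V n w - M w).
  exact: bounded_measurableB.
have YV n : \forall w \ae P, erw_mean X n w = V n w := walk_mean_ae hX n.
have mY n : measurable_fun setT (erw_mean X n) by exact: measurable_funP.
have L2 n : (0 < n)%N -> \int[P]_w ((V n w - M w) ^+ 2) <= 8 / n%:R.
  exact: coin_mean_L2.
have limE (g : R -> R) := Rintegral_limit cI g.
(* The squared difference of the means is at most the mean of [(V n - M) ^+ 2]. *)
have EV : \int[P]_w V n w @[n --> \oo] --> p * (2 * p - 1) ^+ 2.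
  apply: (@cvg_of_sqr_le_div _ _ _ 8) => n n0; apply: le_trans (L2 n n0).
  have <- : \int[P]_w M w = p * (2 * p - 1) ^+ 2 by rewrite (limE id); ring.
  by rewrite -RintegralB_bounded//; exact: sqr_Rintegral_le.
(* Here [M] and [M ^+ 2] have the same mean. The constant is [32 = 4 * 8], since [V n ^+ 2 - M ^+ 2]
   factors and [|V n + M| <= 2]. *)
have EV2 : \int[P]_w (V n w ^+ 2) @[n --> \oo] --> p * (2 * p - 1) ^+ 2.
  apply: (@cvg_of_sqr_le_div _ _ _ 32) => n n0.
  have <- : \int[P]_w (M w ^+ 2) = p * (2 * p - 1) ^+ 2.
    by rewrite (limE (fun x => x ^+ 2)); ring.
  rewrite -RintegralB_bounded; [|exact: bounded_measurableX..].
  have bB : bounded_measurable (fun w => V n w ^+ 2 - M w ^+ 2).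
    by apply: bounded_measurableB; exact: bounded_measurableX.
  apply: le_trans (sqr_Rintegral_le P bB) _.
  apply: (@le_trans _ _ (4 * \int[P]_w ((V n w - M w) ^+ 2))); last first.
    by have := L2 n n0; lra.
  rewrite -RintegralZl_bounded; last exact: bounded_measurableX.
  apply: le_Rintegral_bounded => [||w]; first exact: bounded_measurableX.
    by apply: bounded_measurableM;
      [exact: bounded_measurable_cst | exact: bounded_measurableX].
  have := norm_coin_mean R c n w; have := norm_coin_limit c hp0 hp1 w.
  rewrite -/(V n w) -/(M w) !ler_norml => /andP[? ?] /andP[? ?].
  by rewrite subr_sqr exprMn mulrC ler_wpM2r ?sqr_ge0//; nra.
have EY n : 'E_P[erw_mean X n]%E = (\int[P]_w V n w)%:E.
  by rewrite (expectation_ae_eq (mY n) (bV n).1 (YV n)) expectation_bounded.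
have VY n : 'V_P[erw_mean X n]%E =
    (\int[P]_w (V n w ^+ 2) - (\int[P]_w V n w) ^+ 2)%:E.
  exact: variance_bounded_ae (mY n) (bV n) (YV n).
split; last split.
(* The limit variable is [M] itself, on the space of the walk. *)
- pose mM := isMeasurableFun.Build _ _ _ _ M bM.1.
  pose Z : {RV P >-> R} := HB.pack M mM.
  exists d, Omega, P, Z; split.
    move=> A mA.
    have mZA : measurable (M @^-1` A) by exact: (@measurable_funPTI _ _ _ _ Z).
    transitivity (P (M @^-1` A)) => //.
    have ZA_fin : P (M @^-1` A) \is a fin_num by exact: fin_num_measure.
    rewrite -(fineK ZA_fin).
    (* A probability is the integral of an indicator, so the law follows from [limE]. *)
    have -> : fine (P (M @^-1` A)) = \int[P]_w \1_A (M w).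
      by rewrite /Rintegral -[in LHS](setIT (M @^-1` A)) -integral_indic.
    by rewrite (limE \1_A) !diracE !indicE !EFinD !EFinM.
  apply: cvg_in_distribution_of_probability => e e0.
  have dev_fin n : P [set w | e <= `|erw_mean X n w - Z w|] \is a fin_num.
    by apply: fin_num_measure; exact: measurable_deviation.
  under eq_fun do rewrite -(fineK (dev_fin _)).
  apply: cvg_EFin; first by near=> n.
  apply: (@cvg_of_sqr_le_div _ _ _ (8 / e ^+ 2)) => n n0.
  pose u := fine (P [set w | e <= `|erw_mean X n w - Z w|]).
  change ((u - 0) ^+ 2 <= 8 / e ^+ 2 / n%:R).
  have u0 : 0 <= u by rewrite fine_ge0.
  have u1 : u <= 1.
    rewrite -lee_fin fineK//; apply: probability_le1.
    exact: measurable_deviation.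
  (* A probability [u] satisfies [u ^+ 2 <= u], and Chebyshev's inequality bounds [u]. *)
  apply: (@le_trans _ _ u); first by rewrite subr0; nra.
  have ue : e ^+ 2 * u <= 8 / n%:R.
    apply: le_trans (L2 n n0); rewrite -lee_fin EFinM fineK//.
    have bD : bounded_measurable (fun w => (V n w - M w) ^+ 2).
      exact/bounded_measurableX/bounded_measurableB.
    have mD : measurable_fun setT (fun w => erw_mean X n w - M w).
      by apply: measurable_funB => //; exact: bM.1.
    rewrite -(expectation_bounded P bD) -(expectation_ae_eq _ bD.1
      (f := fun w => (erw_mean X n w - M w) ^+ 2)); first exact: markov_sqr.
    + exact: measurable_funX.
    + by apply: filterS (YV n) => w ->.
  by rewrite mulrAC ler_pdivlMr ?exprn_gt0// mulrC.
- under eq_fun do rewrite EY.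
  by apply: cvg_EFin => //; near=> n.
- under eq_fun do rewrite VY.
  apply: cvg_EFin; first by near=> n.
  (* This rests on [1 - p * (2 * p - 1) ^+ 2 = (1 - p) * (4 * p ^+ 2 + 1)]. *)
  rewrite (_ : p * _ * _ * _ =
    p * (2 * p - 1) ^+ 2 - (p * (2 * p - 1) ^+ 2) ^+ 2); last by ring.
  apply: cvgB => //; rewrite expr2.
  by under eq_fun do rewrite expr2; exact: cvgM.
Unshelve. all: by end_near. Qed.
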